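(* Let $2\le\ell\le n$ be integers. The probability that a uniformly random permutation $\sigma\in\mathcal{S}_n$ has two (distinct) cycles of the same length $j$ for some $j\ge\ell$ is at most $\frac{1}{2(\ell-1)}$.
   Context: $\mathcal{S}_n$ is the symmetric group on $\{1,\ldots,n\}$. *)

(* Defs.v *)
From mathcomp Require Import all_boot all_order all_algebra all_fingroup.

Set Implicit Arguments.
Unset Strict Implicit.
Unset Printing Implicit Defensive.

Import GRing.Theory Num.Theory.
Local Open Scope ring_scope.

(* Probability of E for a uniformly random element of the finite type T
   (only meaningful when T is nonempty). *)
Definition unif_prob (T : finType) (E : {set T}) : rat :=
  #|E|%:R / #|T|%:R.

(* Cycles are the orbits in porbits s, fixed points being the cycles of
   length 1, and the length of a cycle is the cardinality of its orbit. *)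
Definition two_cycles_of_length (n : nat) (s : 'S_n) (j : nat) : bool :=
  [exists C1 in porbits s, exists C2 in porbits s,
     [&& C1 != C2, #|C1| == j & #|C2| == j]].

(* The bound j <= n loses nothing, since a cycle of s has at most n elements;
   it makes the quantifier over j finite, hence decidable. *)
Definition repeated_long_cycle (n l : nat) : {set 'S_n} :=
  [set s : 'S_n | [exists j : 'I_n.+1, (l <= j)%N && two_cycles_of_length s j]].

(* Main.v *)
Require Import Defs.
From mathcomp Require Import all_boot all_order all_algebra all_fingroup.
From mathcomp Require Import ring lra.

Import Order.TTheory GRing.Theory Num.Theory.
Local Open Scope ring_scope.

(** A union bound over the length [j]. If [s] has two distinct [j]-cycles, then
    at least [2 j^2] ordered pairs of points lie on distinct [j]-cycles of [s]:
    take one point on each, in either order ([two_cycles_many_pairs]). On the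
    other hand, the total number of such pairs, over all permutations [s] of a
    set [T], is at most [#|T|!] ([sum_card_cycle_pairs]). Indeed, reading off
    the two cycles from the given points turns a pair into a word of [2j]
    distinct letters; there are [#|T| ^_ (2j)] such words, and a word
    prescribes [s] on its letters, so that it arises from at most
    [(#|T| - 2j)!] permutations. Hence two [j]-cycles occur with probability at
    most [1 / (2 j^2)], which is at most [1 / (2 (j-1)) - 1 / (2 j)], and the
    sum over [j >= l] telescopes. *)

(** All of [A] lies in a single coset of the permutations fixing [S]
    pointwise. *)
Lemma card_perms_agreeing_on (T : finType) (A : {set {perm T}}) (S : {set T}) :
  {in A &, forall s t : {perm T}, {in S, s =1 t}} ->
  (#|A| <= (#|T| - #|S|)`!)%N.
Proof.
move=> agreeA; have [-> | [s0 As0]] := set_0Vmem A; first by rewrite cards0.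
have <- : #|~: S| = (#|T| - #|S|)%N by rewrite -(cardsC S) addKn.
rewrite -card_perm -(card_imset A (mulIg s0^-1%g)).
apply/subset_leq_card/subsetP => _ /imsetP[s As ->].
apply/subsetP => x; rewrite !inE permM; apply: contra => Sx.
by rewrite (agreeA s s0) // permK.
Qed.

Lemma fcycle_traject_porbit (T : finType) (s : {perm T}) (x : T) :
  fcycle s (traject s x #|porbit s x|).
Proof.
case def_n: #|_| (card_porbit_neq0 s x) (iter_porbit s x) => [//|n] _.
move=> /= sKx; rewrite rcons_path fpath_traject /=.
by rewrite last_traject -{2}sKx eqxx.
Qed.

Definition cycle_pairs {T : finType} (s : {perm T}) (j : nat) : {set T * T} :=
  [set p | [&& #|porbit s p.1| == j, #|porbit s p.2| == j
             & p.1 \notin porbit s p.2]].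

(** Two [j]-cycles of [s] written in a row, each with a marked starting point;
    [uniq] makes both words run through a cycle exactly once and the two cycles
    distinct. *)
Definition cycle_words {T : finType} (s : {perm T}) (j : nat) :
    {set (j + j).-tuple T} :=
  [set w : (j + j).-tuple T |
    [&& uniq w, fcycle s (take j w) & fcycle s (drop j w)]].

(** Writing out the cycle from each of the two points is injective, since each
    point is the first letter of its word; this is where [j > 0] matters. *)
Lemma card_cycle_pairs_words (T : finType) (s : {perm T}) (j : nat) :
  (0 < j)%N -> (#|cycle_pairs s j| <= #|cycle_words s j|)%N.
Proof.
case: j => // j _; set m := j.+1.
have szt x : size (traject s x m) == m by rewrite size_traject.
pose word (p : T * T) := cat_tuple (Tuple (szt p.1)) (Tuple (szt p.2)).
have word_inj : injective word.
  move=> [x y] [x' y'] /(congr1 val)/eqP.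
  rewrite [_ == _]eqseq_cat ?size_traject //=.
  by case/andP=> /eqP[-> _] /eqP[-> _].
rewrite -(card_imset _ word_inj); apply/subset_leq_card/subsetP.
move=> _ /imsetP[[x y] /[!inE] /= /and3P[/eqP szx /eqP szy xNy] ->].
rewrite take_size_cat ?drop_size_cat ?size_traject // cat_uniq.
have [uniqx cycx] : uniq (traject s x m) /\ fcycle s (traject s x m).
  by rewrite -szx uniq_traject_porbit fcycle_traject_porbit.
have [uniqy cycy] : uniq (traject s y m) /\ fcycle s (traject s y m).
  by rewrite -szy uniq_traject_porbit fcycle_traject_porbit.
have disj : ~~ has [in traject s x m] (traject s y m).
  apply/hasPn => z; rewrite -{1}szy -porbit_traject -eq_porbit_mem => /eqP zy.
  apply: contra xNy => zx; rewrite -eq_porbit_mem eq_sym -zy.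
  by rewrite eq_porbit_mem porbit_traject szx.
by apply/and3P; split=> //; apply/and3P.
Qed.

(** Both cyclic words are read off [w], so [s] must send each letter of [w] to
    its cyclic successor. *)
Lemma cycle_words_agree (T : finType) (s t : {perm T}) (j : nat)
    (w : (j + j).-tuple T) :
  w \in cycle_words s j -> w \in cycle_words t j -> {in w, s =1 t}.
Proof.
rewrite !inE => /and3P[_ s1 s2] /and3P[_ t1 t2] x.
have -> : (x \in w) = (x \in take j w ++ drop j w) by rewrite cat_take_drop.
rewrite mem_cat.
by case/orP=> wx; [move: s1 t1 | move: s2 t2];
  move=> /(next_cycle)/(_ wx)/eqP-> /(next_cycle)/(_ wx)/eqP->.
Qed.

(** Double counting: each of the [#|T| ^_ (2j)] words without repetition is read
    off from at most [(#|T| - 2j)!] permutations. *)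
Lemma sum_card_cycle_words (T : finType) (j : nat) :
  (\sum_(s : {perm T}) #|cycle_words s j| <= #|T|`!)%N.
Proof.
pose perms_of (w : (j + j).-tuple T) := [set s | w \in cycle_words s j].
have -> : (\sum_(s : {perm T}) #|cycle_words s j|
           = \sum_(w : (j + j).-tuple T | uniq w) #|perms_of w|)%N.
  under eq_bigr do rewrite -sum1_card.
  rewrite (exchange_big_dep (fun w : (j + j).-tuple T => uniq w)) /=.
    apply: eq_bigr => w _; rewrite -sum1_card.
    by apply: eq_bigl => s; rewrite !inE.
  by move=> s w _; rewrite inE => /and3P[].
have le_fibre (w : (j + j).-tuple T) : uniq w ->
    (#|perms_of w| <= (#|T| - (j + j))`!)%N.
  move=> /card_uniqP; rewrite size_tuple => <-.
  have -> : #|w| = #|[set x in w]| by rewrite cardsE.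
  apply: card_perms_agreeing_on => s t; rewrite [_ \in perms_of w]inE => sw.
  by rewrite [_ \in perms_of w]inE => tw x /[!inE]; apply: cycle_words_agree.
apply: leq_trans (leq_sum _ le_fibre) _.
rewrite sum_nat_const.
have -> : #|[pred w : (j + j).-tuple T | uniq w]| = (#|T| ^_ (j + j))%N.
  rewrite -(card_uniq_tuples _ predT); apply: eq_card => w.
  by rewrite !inE all_predT.
have [le_T | lt_T] := leqP (j + j) #|T|; first by rewrite ffact_fact.
by rewrite ffact_small.
Qed.

Lemma sum_card_cycle_pairs (T : finType) (j : nat) : (0 < j)%N ->
  (\sum_(s : {perm T}) #|cycle_pairs s j| <= #|T|`!)%N.
Proof.
move=> j_gt0; apply: leq_trans (sum_card_cycle_words T j).
by apply: leq_sum => s _; apply: card_cycle_pairs_words.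
Qed.

(** The products of the two cycles, taken in both orders, are disjoint sets of
    [j^2] pairs. *)
Lemma two_cycles_many_pairs (n : nat) (s : 'S_n) (j : nat) :
  two_cycles_of_length s j -> (2 * j ^ 2 <= #|cycle_pairs s j|)%N.
Proof.
case/exists_inP=> _ /imsetP[a _ ->] /exists_inP[_ /imsetP[b _ ->]].
case/and3P=> neq_ab /eqP sza /eqP szb.
have sub x y : porbit s x != porbit s y -> #|porbit s x| = j ->
    #|porbit s y| = j -> setX (porbit s x) (porbit s y) \subset cycle_pairs s j.
  move=> neq szx szy; apply/subsetP => -[u v] /[!inE] /=.
  rewrite -!eq_porbit_mem => /andP[/eqP-> /eqP->].
  by rewrite szx szy neq !eqxx.
have disj : setX (porbit s a) (porbit s b) :&: setX (porbit s b) (porbit s a)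
            = set0.
  apply/setP => -[u v] /[!inE] /=; apply/negP; rewrite -!eq_porbit_mem.
  by case/andP=> /andP[/eqP ua _] /andP[/eqP ub _]; rewrite -ua -ub eqxx in neq_ab.
have -> : (2 * j ^ 2 = #|setX (porbit s a) (porbit s b)
                         :|: setX (porbit s b) (porbit s a)|)%N.
  by rewrite cardsU disj cards0 subn0 !cardsX sza szb addnn -mul2n mulnn.
by apply: subset_leq_card; rewrite subUset !sub // eq_sym.
Qed.

Lemma card_two_cycles (n j : nat) : (0 < j)%N ->
  (#|[set s : 'S_n | two_cycles_of_length s j]| * (2 * j ^ 2) <= n`!)%N.
Proof.
move=> j_gt0; have := sum_card_cycle_pairs 'I_n j j_gt0; rewrite card_ord.
apply: leq_trans; rewrite -sum_nat_const.
apply: leq_trans (leq_sum _ _) _ => [s | ].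
  by rewrite inE; apply: two_cycles_many_pairs.
by rewrite [leqRHS](bigID [in [set s : 'S_n | two_cycles_of_length s j]]) leq_addr.
Qed.

(** Termwise, [1 / (2 j^2) <= 1 / (2 j (j - 1)) = f (j + 1) - f j] for
    [f j := - 1 / (2 (j - 1))]. *)
Lemma sum_inv_double_sqr (n l : nat) : (2 <= l)%N -> (l <= n)%N ->
  \sum_(l <= j < n.+1) (2%:R * j%:R ^+ 2)^-1 <= 1 / (2%:R * (l%:R - 1)) :> rat.
Proof.
move=> l_ge2 le_ln; pose f j : rat := - (2%:R * (j%:R - 1))^-1.
have le_term j : (l <= j < n.+1)%N -> (2%:R * j%:R ^+ 2)^-1 <= f j.+1 - f j.
  case/andP=> le_lj _; have j_ge2 : 2%:R <= j%:R :> rat.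
    by rewrite ler_nat (leq_trans l_ge2).
  have -> : f j.+1 - f j = (2%:R * (j%:R * (j%:R - 1)))^-1.
    rewrite /f -natr1; field; apply/andP; split; apply/lt0r_neq0; lra.
  rewrite lef_pV2 ?posrE; nra.
apply: le_trans (ler_sum_nat le_term) _.
rewrite telescope_sumr ?leqW // /f opprK mul1r gerDr oppr_le0.
by rewrite invr_ge0 mulr_ge0 ?subr_ge0 ?ler1n.
Qed.

Theorem corollary1p10 (n l : nat) (hl : (2 <= l)%N) (hln : (l <= n)%N) :
  unif_prob (repeated_long_cycle n l) <= 1 / (2%:R * (l%:R - 1)).
Proof.
pose B j := [set s : 'S_n | two_cycles_of_length s j].
have n_gt0 : 0 < n`!%:R :> rat by rewrite ltr0n fact_gt0.
have card_S : #|[the finType of 'S_n]| = n`!.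
  by rewrite -card_Sn; apply: eq_card => s; rewrite !inE.
apply: le_trans (sum_inv_double_sqr n l hl hln).
rewrite /unif_prob card_S ler_pdivrMr // mulr_suml.
have le_union : (#|repeated_long_cycle n l| <= \sum_(l <= j < n.+1) #|B j|)%N.
  have -> : repeated_long_cycle n l = \bigcup_(j < n.+1 | (l <= j)%N) B j.
    apply/setP => s; rewrite inE.
    apply/existsP/bigcupP => [[j /andP[lj sj]] | [j lj]].
      by exists j; rewrite ?inE.
    by rewrite inE => sj; exists j; rewrite lj.
  rewrite big_geq_mkord /=.
  elim/big_rec2: _ => [|j m A _ le_Am]; first by rewrite cards0.
  by rewrite (leq_trans (leq_card_setU _ _)) ?leq_add2l.
apply: le_trans (_ : (\sum_(l <= j < n.+1) #|B j|)%N%:R <= _).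
  by rewrite ler_nat.
rewrite natr_sum; apply: ler_sum_nat => j /andP[le_lj _].
have j_gt0 : (0 < j)%N by apply: leq_trans le_lj; apply: leq_trans hl.
rewrite mulrC ler_pdivlMr ?mulr_gt0 ?exprn_gt0 ?ltr0n //.
by rewrite -natrX -!natrM ler_nat card_two_cycles.
Qed.
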